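(* Let $k\ge2$ be an integer, $G=(V,E)$ a 2-edge-connected undirected graph with bidirected graph $\vec G=(V,E^+\cup E^-)$, and $c:E^+\cup E^-\to\mathbb{Z}_{\ge0}$. Let $z^*$ be an extreme point optimal solution of the linear program $\min\{c^\top z: z\in\mathcal P_k\}$, where $$\mathcal P_k=\{z\in\mathbb{R}^{E^+\cup E^-}:\ z(\delta^+_{\vec G}(v))=z(\delta^-_{\vec G}(v))\ \forall v\in V,\ 1\le z(e^+)+z(e^-)\le k-1\ \forall e\in E,\ z\ge0\}.$$ Then: (1) for every $e\in E$, if $z^*(e^+)>0$ and $z^*(e^-)>0$, then $z^*(e^+)+z^*(e^-)=1$; (2) for every $e\in E$, $z^*(e^+)\in\mathbb{Z}$ if and only if $z^*(e^-)\in\mathbb{Z}$; (3) for every $e\in E^+\cup E^-$, if $z^*(e)$ is non-integral then $z^*(e)=\frac12$; (4) the integral arcs of $z^*$ form a $k$-flow: letting $A=\{a\in E^+\cup E^-: z^*(a)\in\mathbb{Z},\ z^*(a)>0\}$, $A$ contains at most one of $e^+,e^-$ for each $e\in E$, $z^*(a)\in\{1,\dots,k-1\}$ for all $a\in A$, and $z^*(\delta^+_A(v))=z^*(\delta^-_A(v))$ for every $v\in V$.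
   Context: The bidirected graph $\vec G$ has two oppositely oriented arcs $e^+,e^-$ per edge $e$. For a set of arcs $A$ and $v\in V$, $\delta^\pm_A(v)$ are the arcs of $A$ leaving/entering $v$, and $z(A)=\sum_{a\in A}z(a)$.
   Formalization: For k > 2 it is additionally assumed that every edge e has c(e⁺)+c(e⁻) > 0; without this the claim fails, e.g. k = 3, c = 0, three parallel edges, z* = 1 on e1⁺, e2⁻, e3⁺, e3⁻ and 0 elsewhere, where e3 has total 2 with both arcs positive. *)

(* Defs.v *)
From HB Require Import structures.
From mathcomp Require Import all_boot all_order all_algebra.
From mathcomp Require Import reals.

Set Implicit Arguments.
Unset Strict Implicit.
Unset Printing Implicit Defensive.

Import Order.TTheory GRing.Theory Num.Theory.
Local Open Scope ring_scope.

(* A finite undirected multigraph (parallel edges and loops allowed) is given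
   by a map [ends : E -> V * V].  The order of the two ends carries no meaning
   for the graph; it only fixes which of the two arcs of e is called e^+. *)

Definition adj (V E : finType) (ends : E -> V * V) (F : {set E}) : rel V :=
  [rel x y | [exists e in F, (ends e == (x, y)) || (ends e == (y, x))]].

Definition graph_connected (V E : finType) (ends : E -> V * V) (F : {set E}) :=
  forall x y : V, connect (adj ends F) x y.

Definition two_edge_connected (V E : finType) (ends : E -> V * V) :=
  graph_connected ends [set: E] /\
  forall e : E, graph_connected ends [set~ e].

Definition diarc (E : finType) : finType := (E * bool)%type.

Definition arc_plus (E : finType) (e : E) : diarc E := (e, true).
Definition arc_minus (E : finType) (e : E) : diarc E := (e, false).

Definition arc_tail (V E : finType) (ends : E -> V * V) (a : diarc E) : V :=
  if a.2 then (ends a.1).1 else (ends a.1).2.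
Definition arc_head (V E : finType) (ends : E -> V * V) (a : diarc E) : V :=
  if a.2 then (ends a.1).2 else (ends a.1).1.

Definition delta_out (V E : finType) (ends : E -> V * V)
    (A : {set diarc E}) (v : V) : {set diarc E} :=
  [set a in A | arc_tail ends a == v].
Definition delta_in (V E : finType) (ends : E -> V * V)
    (A : {set diarc E}) (v : V) : {set diarc E} :=
  [set a in A | arc_head ends a == v].

Definition arc_sum (R : realType) (E : finType) (z : {ffun diarc E -> R})
    (A : {set diarc E}) : R :=
  \sum_(a in A) z a.

Definition balanced (R : realType) (V E : finType) (ends : E -> V * V)
    (z : {ffun diarc E -> R}) (A : {set diarc E}) :=
  forall v : V, arc_sum z (delta_out ends A v) = arc_sum z (delta_in ends A v).

Definition flow_polytope (R : realType) (V E : finType) (ends : E -> V * V) (k : nat)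
    (z : {ffun diarc E -> R}) : Prop :=
  [/\ balanced ends z [set: diarc E],
      forall e : E, 1 <= z (arc_plus e) + z (arc_minus e) <= k%:R - 1
    & forall a : diarc E, 0 <= z a].

Definition cost (R : realType) (E : finType) (c : diarc E -> nat)
    (z : {ffun diarc E -> R}) : R :=
  \sum_(a : diarc E) (c a)%:R * z a.

Definition extreme_point (R : realType) (E : finType)
    (P : {ffun diarc E -> R} -> Prop) (z : {ffun diarc E -> R}) : Prop :=
  P z /\
  forall (x y : {ffun diarc E -> R}) (t : R),
    P x -> P y -> 0 < t < 1 ->
    (forall a, z a = t * x a + (1 - t) * y a) -> x = z /\ y = z.

Definition optimal_solution (R : realType) (E : finType) (c : diarc E -> nat)
    (P : {ffun diarc E -> R} -> Prop) (z : {ffun diarc E -> R}) : Prop :=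
  P z /\ forall z' : {ffun diarc E -> R}, P z' -> cost c z <= cost c z'.

(* Individual arcs may be free, but no edge is free in both directions.  For
   k > 2 this cannot be dropped from the theorem: take k = 3, c = 0 and three
   parallel edges e1, e2, e3 with ends (u, v).  The point with value 1 on e1^+,
   e2^-, e3^+, e3^- and 0 on e1^-, e2^+ is an optimal extreme point, although
   e3 carries total value 2 with both of its arcs positive. *)
Definition no_free_edge (E : finType) (c : diarc E -> nat) :=
  forall e : E, (0 < c (arc_plus e) + c (arc_minus e))%N.

Definition integral_arcs (R : realType) (E : finType)
    (z : {ffun diarc E -> R}) : {set diarc E} :=
  [set a | (z a \is a Num.int) && (0 < z a)].

Definition k_flow (R : realType) (V E : finType) (ends : E -> V * V) (k : nat)
    (A : {set diarc E}) (z : {ffun diarc E -> R}) : Prop :=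
  [/\ forall e : E, ~~ ((arc_plus e \in A) && (arc_minus e \in A)),
      forall a : diarc E, a \in A ->
        exists2 n : nat, (1 <= n <= k - 1)%N & z a = n%:R
    & balanced ends z A].

(* Main.v *)
(* Lowering both arcs of a two-sided edge of total value above 1 would reduce the
   cost, which gives (1); for k = 2 the constraints already force total 1.  Now
   let S be the set of edges whose net value z(e^+) - z(e^-) is not an integer.
   By flow conservation no vertex has
   degree one in S, so if S is nonempty it carries a nonzero circulation.  No
   constraint that is tight on an edge of S forbids pushing a little of this
   circulation in either direction, against extremality.  Hence all net values
   are integers: a one-sided edge is integral, and a two-sided edge, having
   total 1 and net value in (-1, 1), has both arcs equal to 1/2. *)

Require Import Defs.
From mathcomp Require Import all_boot all_order all_algebra.
From mathcomp Require Import reals.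
From mathcomp Require Import ring lra zify.
Import Order.TTheory GRing.Theory Num.Theory.
Local Open Scope ring_scope.

Set Implicit Arguments.
Unset Strict Implicit.
Unset Printing Implicit Defensive.

Definition arc_rev (E : finType) (a : diarc E) : diarc E := (a.1, ~~ a.2).

Lemma arc_revK (E : finType) : involutive (@arc_rev E).
Proof. by case=> e b; rewrite /arc_rev /= negbK. Qed.

Lemma arc_tail_rev (V E : finType) (ends : E -> V * V) (a : diarc E) :
  arc_tail ends (arc_rev a) = arc_head ends a.
Proof. by case: a => e []. Qed.

(** Reversal maps the arcs entering [v] bijectively to those leaving it, so both sides of the
    balance merge into one sum over leaving arcs. The two memberships stay separate because [A] need
    not be closed under reversal. *)
Lemma balancedP (R : realType) (V E : finType) (ends : E -> V * V)
    (z : {ffun diarc E -> R}) (A : {set diarc E}) :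
  balanced ends z A <->
  forall v, \sum_(a | arc_tail ends a == v)
    (z a *+ (a \in A) - z (arc_rev a) *+ (arc_rev a \in A)) = 0.
Proof.
have sumE v : \sum_(a | arc_tail ends a == v)
    (z a *+ (a \in A) - z (arc_rev a) *+ (arc_rev a \in A)) =
    arc_sum z (delta_out ends A v) - arc_sum z (delta_in ends A v).
  rewrite big_split sumrN /arc_sum; congr (_ - _).
    rewrite [RHS](eq_bigl (fun a => (arc_tail ends a == v) && (a \in A))).
      by rewrite big_mkcondr; apply: eq_bigr => a _; case: ifP.
    by move=> a; rewrite !inE andbC.
  rewrite (reindex_inj (inv_inj (@arc_revK E))).
  under eq_bigl => a do rewrite arc_tail_rev.
  rewrite [RHS](eq_bigl (fun a => (arc_head ends a == v) && (a \in A))).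
    by rewrite big_mkcondr; apply: eq_bigr => a _; rewrite arc_revK; case: ifP.
  by move=> a; rewrite !inE andbC.
by split=> h v; [rewrite sumE h subrr | apply/eqP; rewrite -subr_eq0 -sumE h].
Qed.

(* If no vertex has degree one in S, then S has at least as many edges as it
   touches vertices, whereas each row of its signed incidence matrix sums to
   zero; so the rows are linearly dependent. *)
Lemma exists_circulation (F : fieldType) (V E : finType) (ends : E -> V * V)
    (S : {set E}) :
  S != set0 ->
  (forall v, #|[set a : diarc E | (a.1 \in S) && (arc_tail ends a == v)]| != 1%N) ->
  exists h : diarc E -> F,
    [/\ exists a, h a != 0,
        forall a, a.1 \notin S -> h a = 0,
        forall a, h (arc_rev a) = - h a
      & forall v, \sum_(a | arc_tail ends a == v) h a = 0].
Proof.
move=> S0 degS.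
pose D v := [set a : diarc E | (a.1 \in S) && (arc_tail ends a == v)].
pose W := [set v | D v != set0].
(* Double counting of arcs over [S]: each edge gives two arcs, and each vertex of [W] is the tail of
   at least two. *)
have WS : (#|W| <= #|S|)%N.
  have cardD : (\sum_(v in W) #|D v| <= #|S| * 2)%N.
    rewrite -card_bool -cardsT -cardsX.
    have -> : (\sum_(v in W) #|D v| =
               \sum_(v in W) \sum_(a in setX S [set: bool] | arc_tail ends a == v) 1)%N.
      apply: eq_bigr => v _; rewrite -sum1_card; apply: eq_bigl => -[e b].
      by rewrite !inE andbT.
    rewrite -sum1_card (partition_big (arc_tail ends) xpredT) //=.
    by rewrite [leqRHS](bigID (mem W)) leq_addr.
  rewrite -(leq_pmul2r (isT : 0 < 2)%N) (leq_trans _ cardD) //.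
  rewrite -sum_nat_const leq_sum // => v; rewrite inE -card_gt0 => Dv.
  by have := degS v; rewrite -/(D v); case: #|D v| Dv => [|[|]].
(* [M] is the signed incidence matrix of [S], one row per edge; the two entries of a loop cancel. *)
pose sg (b : bool) : F := (-1) ^+ b.
pose M := \matrix_(i < #|S|, j < #|W|)
  \sum_(b : bool) (arc_tail ends ((enum_val i, b) : diarc E) == enum_val j)%:R * sg b.
have inW e b : e \in S -> arc_tail ends ((e, b) : diarc E) \in W.
  by move=> eS; rewrite inE; apply/set0Pn; exists (e, b); rewrite inE eS eqxx.
have M1 : M *m (const_mx 1 : 'cV_#|W|) = 0.
  apply/matrixP => i j; rewrite !mxE.
  under eq_bigr => l _ do rewrite !mxE mulr1.
  rewrite exchange_big /=.
  have sum1 b : \sum_(l < #|W|)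
     (arc_tail ends ((enum_val i, b) : diarc E) == enum_val l)%:R * sg b = sg b.
    have vW := inW _ b (enum_valP i).
    rewrite (bigD1 (enum_rank_in vW (arc_tail ends ((enum_val i, b) : diarc E)))) //=.
    rewrite enum_rankK_in // eqxx mul1r big1 ?addr0 // => l ll.
    case: eqP => [E0|]; last by rewrite mul0r.
    by case/eqP: ll; apply: enum_val_inj; rewrite enum_rankK_in.
  by under eq_bigr do rewrite sum1; rewrite big_bool /sg /= addrC subrr.
have [e0 e0S] := set0Pn _ S0.
have W_gt0 : (0 < #|W|)%N by apply/card_gt0P; eexists; exact: inW e0 true e0S.
(* The nonzero all-ones column is killed by [M], which costs one in the rank. With [WS], the rank is
   then below the number of rows, which yields the row vector [u]. *)
have rk : (\rank M < #|W|)%N.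
  have := mulmx0_rank_max M1; apply: leq_trans.
  rewrite -addn1 leq_add2l lt0n mxrank_eq0; apply/eqP => /matrixP.
  by move=> /(_ (Ordinal W_gt0) 0); rewrite !mxE; apply/eqP/oner_neq0.
have : kermx M != 0.
  by rewrite -mxrank_eq0 mxrank_ker subn_eq0 -ltnNge (leq_trans rk).
case/rowV0Pn => u /sub_kermxP uM u0.
pose w e := \sum_(i < #|S|) (enum_val i == e)%:R * u 0 i.
have w_val i : w (enum_val i) = u 0 i.
  rewrite /w (bigD1 i) //= eqxx mul1r big1 ?addr0 // => j ji.
  by rewrite (inj_eq enum_val_inj) (negPf ji) mul0r.
have w_out e : e \notin S -> w e = 0.
  move=> eS; rewrite /w big1 // => i _; case: eqP => [E0|]; last by rewrite mul0r.
  by rewrite -E0 enum_valP in eS.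
(* The kernel vector, extended by zero outside [S], gets the sign of the orientation, so that
   reversal negates it. *)
exists (fun a => sg a.2 * w a.1); split.
- have /rV0Pn [i ui] : u != 0 by [].
  by exists (enum_val i, false); rewrite /= w_val /sg mul1r.
- by move=> a /w_out ->; rewrite mulr0.
- by move=> [e []]; rewrite /sg /= ?expr1 ?expr0 ?mulN1r ?mul1r ?opprK.
move=> v; have [vW|vW] := boolP (v \in W); last first.
  apply: big1 => -[e b] /= /eqP tv; rewrite w_out ?mulr0 //.
  by apply: contra vW => eS; rewrite -tv inW.
have := congr1 (fun A : 'rV_#|W| => A 0 (enum_rank_in vW v)) uM.
rewrite !mxE => {2}<-.
under [RHS]eq_bigr => i _ do
  rewrite mxE enum_rankK_in // -w_val.
rewrite -(big_enum_val (A := mem S) (fun e => w e *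
   \sum_(b : bool) (arc_tail ends ((e, b) : diarc E) == v)%:R * sg b)) /=.
rewrite big_mkcond /= -(pair_bigA _ (fun e b =>
   if arc_tail ends ((e, b) : diarc E) == v then sg b * w e else 0)) /=.
rewrite [RHS]big_mkcond /=; apply: eq_bigr => e _.
case: ifPn => [eS|/w_out we].
  by rewrite mulr_sumr; apply: eq_bigr => b _; case: ifP => _;
    rewrite ?mul1r ?mul0r ?mulr0 // mulrC.
by rewrite big1 // => b _; rewrite we mulr0 if_same.
Qed.

(** Here [u] is the slack of finitely many constraints and [l] the rate at which a direction
    consumes it; tight constraints are not moved, so a common positive step exists. *)
Lemma exists_step (R : realFieldType) (I : finType) (u l : I -> R) :
  (forall i, 0 <= u i) -> (forall i, u i = 0 -> l i = 0) ->
  exists2 eps, 0 < eps & forall i, eps * `|l i| <= u i.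
Proof.
(* The summand 1 keeps [s] positive when all ratios vanish; a tight constraint contributes 0, as
   division by zero gives 0. *)
move=> u_ge0 ul0; pose s := 1 + \sum_i `|l i| / u i.
have t_ge0 i : 0 <= `|l i| / u i by rewrite divr_ge0.
have s_gt0 : 0 < s by rewrite ltr_wpDr ?ltr01 ?sumr_ge0.
exists s^-1 => [|i]; first by rewrite invr_gt0.
rewrite mulrC ler_pdivrMr //.
have [/[dup] /ul0 -> ->|ui] := eqVneq (u i) 0; first by rewrite normr0 mul0r.
have ui_gt0 : 0 < u i by rewrite lt_def ui u_ge0.
rewrite mulrC -ler_pdivrMr // /s (bigD1 i) //= addrCA lerDl.
by rewrite addr_ge0 ?sumr_ge0.
Qed.

(** For a small step [eps], both [z + eps * d] and [z - eps * d] are feasible and [z] is their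
    midpoint, so extremality makes them equal to [z]. *)
Lemma extreme_point_rigid (R : realType) (k : nat) (V E : finType)
    (ends : E -> V * V) (z : {ffun diarc E -> R}) (d : diarc E -> R) :
  extreme_point (flow_polytope ends k) z ->
  (forall v, \sum_(a | arc_tail ends a == v) (d a - d (arc_rev a)) = 0) ->
  (forall a, z a = 0 -> d a = 0) ->
  (forall e, d (arc_plus e) + d (arc_minus e) = 0 \/
     1 < z (arc_plus e) + z (arc_minus e) < k%:R - 1) ->
  forall a, d a = 0.
Proof.
move=> [[/balancedP zbal zsum z_ge0] zext] dbal dz dsum.
pose de e := d (arc_plus e) + d (arc_minus e).
pose ze e := z (arc_plus e) + z (arc_minus e).
(* One step length for each family of constraints: nonnegativity, lower bounds and upper bounds on
   edge totals. *)
have [e1 e1_gt0 h1] := @exists_step R _ z d z_ge0 dz.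
have [|e|e2 e2_gt0 h2] := @exists_step R _ (fun e => ze e - 1) de.
- by move=> e; have /andP[+ _] := zsum e; rewrite subr_ge0.
- case: (dsum e) => // /andP[+ _] /eqP; rewrite subr_eq0 => /[swap] /eqP.
  by rewrite /ze => ->; rewrite ltxx.
have [|e|e3 e3_gt0 h3] := @exists_step R _ (fun e => k%:R - 1 - ze e) de.
- by move=> e; have /andP[_ +] := zsum e; rewrite subr_ge0.
- case: (dsum e) => // /andP[_ +] /eqP; rewrite subr_eq0 => /[swap] /eqP.
  by rewrite /ze => ->; rewrite ltxx.
pose eps := Num.min e1 (Num.min e2 e3).
have eps_gt0 : 0 < eps by rewrite !lt_min e1_gt0 e2_gt0.
have le1 : eps <= e1 by rewrite ge_min lexx.
have le2 : eps <= e2 by rewrite !ge_min lexx orbT.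
have le3 : eps <= e3 by rewrite !ge_min lexx !orbT.
have feas s : `|s| = eps -> flow_polytope ends k [ffun a => z a + s * d a].
  move=> ns.
  have bnd (e u l : R) : eps <= e -> e * `|l| <= u -> - u <= s * l <= u.
    move=> lee leu; rewrite -ler_norml normrM ns (le_trans _ leu) //.
    by rewrite ler_wpM2r.
  split=> [|e|a].
  - apply/balancedP => v; rewrite -[RHS](addr0 0) -[X in _ = X + _](zbal v).
    rewrite -[X in _ = _ + X](mulr0 s) -[X in _ = _ + _ * X](dbal v).
    rewrite mulr_sumr -big_split; apply: eq_bigr => a _ /=.
    by rewrite !in_setT !ffunE !mulr1n; ring.
  - have := bnd _ _ _ le2 (h2 e); have := bnd _ _ _ le3 (h3 e).
    by rewrite !ffunE /de /ze; lra.
  - by have := bnd _ _ _ le1 (h1 a); rewrite ffunE; lra.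
have [||||zd _] := zext _ _ 2^-1 (feas eps _) (feas (- eps) _).
- by rewrite gtr0_norm.
- by rewrite normrN gtr0_norm.
- by lra.
- by move=> a; rewrite !ffunE; field.
move=> a; have /eqP := ffunE (fun a => z a + eps * d a) a; rewrite zd.
by rewrite eq_sym -subr_eq0 addrAC subrr add0r mulf_eq0 gt_eqF //= => /eqP.
Qed.

(** Equal decreases on the two arcs of an edge cancel in every balance equation, while the cost
    drops because one of the two arcs has positive cost. *)
Lemma optimal_two_sided (R : realType) (k : nat) (V E : finType)
    (ends : E -> V * V) (c : diarc E -> nat) (z : {ffun diarc E -> R}) (e : E) :
  ((2 < k)%N -> no_free_edge c) ->
  optimal_solution c (flow_polytope ends k) z ->
  0 < z (arc_plus e) -> 0 < z (arc_minus e) ->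
  z (arc_plus e) + z (arc_minus e) = 1.
Proof.
move=> hc [[/balancedP zbal zsum z_ge0] zopt] zp zm.
have /andP[s_ge1 s_lek] := zsum e.
have [k_gt2|k_le2] := ltnP 2 k; last first.
  apply/eqP; rewrite eq_le s_ge1 andbT (le_trans s_lek) // lerBlDr.
  by rewrite -[1 + 1]/(2%:R) ler_nat.
have ce := hc k_gt2 e; apply/eqP; rewrite eq_le s_ge1 andbT leNgt.
apply/negP => s_gt1.
(* Both arcs lose [dl], so half the excess over 1 keeps the total at least 1; the other two terms
   keep the arcs nonnegative. *)
pose dl := Num.min (z (arc_plus e)) (Num.min (z (arc_minus e))
  ((z (arc_plus e) + z (arc_minus e) - 1) / 2)).
have dl_gt0 : 0 < dl by rewrite !lt_min zp zm divr_gt0 ?subr_gt0 ?ltr0n.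
have dl1 : dl <= z (arc_plus e) by rewrite ge_min lexx.
have dl2 : dl <= z (arc_minus e) by rewrite !ge_min lexx orbT.
have dl3 : dl <= (z (arc_plus e) + z (arc_minus e) - 1) / 2.
  by rewrite !ge_min lexx !orbT.
pose y : {ffun diarc E -> R} := [ffun a => z a - dl *+ (a.1 == e)].
have y_ge0 a : 0 <= y a.
  rewrite ffunE; case: eqP => [E0|_]; last by rewrite subr0.
  by rewrite subr_ge0; case: a E0 => e' [] /= ->.
have Py : flow_polytope ends k y.
  split=> // [|f].
  - apply/balancedP => v; rewrite -[RHS](zbal v); apply: eq_bigr => a _.
    by rewrite !in_setT !ffunE /=; ring.
  - rewrite !ffunE /=; have := zsum f; case: eqP => [->|_]; last by rewrite !subr0.
    by rewrite !mulr1n; lra.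
have := zopt _ Py; apply/negP; rewrite -ltNge -subr_gt0 /cost -sumrB.
have -> : \sum_a ((c a)%:R * z a - (c a)%:R * y a) =
    \sum_(a | a.1 == e) (c a)%:R * dl.
  rewrite [RHS]big_mkcond; apply: eq_bigr => a _; rewrite ffunE.
  by case: eqP => _; rewrite ?mulr1n ?mulr0n; ring.
rewrite -mulr_suml mulr_gt0 // -natr_sum ltr0n.
apply: leq_trans ce _.
rewrite (bigD1 (arc_plus e)); last exact: eqxx.
have minus_plus : arc_minus e != arc_plus e by apply/eqP; case.
by rewrite leq_add2l (bigD1 (arc_minus e)) ?leq_addr ?minus_plus ?eqxx.
Qed.

Lemma extreme_net_integral (R : realType) (k : nat) (V E : finType)
    (ends : E -> V * V) (z : {ffun diarc E -> R}) :
  extreme_point (flow_polytope ends k) z ->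
  (forall e, 0 < z (arc_plus e) -> 0 < z (arc_minus e) ->
     z (arc_plus e) + z (arc_minus e) = 1) ->
  forall a, z a - z (arc_rev a) \is a Num.int.
Proof.
move=> zext two.
have [[/balancedP zbal zsum z_ge0] _] := zext.
pose net (a : diarc E) : R := z a - z (arc_rev a).
have netN a : net (arc_rev a) = - net a by rewrite /net arc_revK opprB.
pose S := [set e | net (arc_plus e) \isn't a Num.int].
have inS a : (a.1 \in S) = (net a \isn't a Num.int).
  case: a => e []; rewrite inE //= -[(e, false)]/(arc_rev (arc_plus e)).
  by rewrite netN rpredN.
suff S0 : S = set0 by move=> a; have := inS a; rewrite S0 inE => /esym/negbFE.
apply/eqP/negPn/negP => Sn0.
have degS v : #|[set a : diarc E | (a.1 \in S) && (arc_tail ends a == v)]| != 1%N.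
  apply/negP => /cards1P [a0 /setP D1].
  have Da a : (a.1 \in S) && (arc_tail ends a == v) = (a == a0).
    by have := D1 a; rewrite in_set in_set1.
  have := Da a0; rewrite eqxx inS => /andP[a0S /eqP a0v].
  have := zbal v; rewrite (bigD1 a0) /=; last by rewrite a0v.
  (* Conservation at [v] writes the net value of [a0] as minus a sum of integers, a
     contradiction. *)
  move=> /eqP; rewrite !in_setT !mulr1n addr_eq0 => /eqP net0.
  move: a0S; rewrite /net net0 rpredN => /negP; apply.
  apply: rpred_sum => a /andP[av aa0]; rewrite !in_setT !mulr1n.
  have := Da a; rewrite (negPf aa0) av andbT inS => /negbFE.
  by [].
have [h [[a0 ha0] hS hN hbal]] := exists_circulation R Sn0 degS.
(* The weights keep the total of a two-sided edge fixed, leave null arcs null,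
   and make the net change along every edge equal to [2 h]. *)
pose d a := h a *+ (if z a == 0 then 0 else if z (arc_rev a) == 0 then 2 else 1).
have netd a : d a - d (arc_rev a) = h a *+ 2.
  rewrite /d arc_revK hN.
  case: (altP (z a =P 0)) => za; case: (altP (z (arc_rev a) =P 0)) => zr;
    rewrite ?mulr0n ?mulr1n; try ring.
  (* If both arcs are null, the net value is 0, so the edge lies outside [S] and [h] vanishes on
     it. *)
  have /hS -> : a.1 \notin S by rewrite inS negbK /net za zr subrr.
  by ring.
have d0 : forall a, d a = 0.
  apply: (@extreme_point_rigid R k V E ends z d) => //.
  - move=> v; under eq_bigr => a _ do rewrite netd.
    by rewrite sumrMnl hbal mul0rn.
  - by move=> a za; rewrite /d za eqxx.
  move=> e.
  have [eS|eS] := boolP (e \in S); last first.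
    by left; rewrite /d !hS // !mul0rn addr0.
  have netS := eS; rewrite inE /net -[arc_rev _]/(arc_minus e) in netS.
  have /andP[s1 sk] := zsum e.
  (* The bounds are integers, and the total of a one-sided edge is its net value up to sign; on an
     edge of [S] it is therefore non-integral and meets neither bound. *)
  have strict (x : R) : x \isn't a Num.int -> 1 <= x <= k%:R - 1 -> 1 < x < k%:R - 1.
    move=> xint /andP[x1 xk]; rewrite !lt_def x1 xk !andbT.
    apply/andP; split; apply: contra xint => /eqP.
      by move=> ->; rewrite rpred1.
    by move=> <-; rewrite rpredB ?rpred1 ?rpred_nat.
  have hm : h (arc_minus e) = - h (arc_plus e) by rewrite -hN.
  have [zp|zp] := eqVneq (z (arc_plus e)) 0; [|have [zm|zm] := eqVneq (z (arc_minus e)) 0].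
  - right; apply: strict; last by rewrite s1.
    by apply: contra netS; rewrite zp add0r sub0r rpredN.
  - right; apply: strict; last by rewrite s1.
    by apply: contra netS; rewrite zm addr0 subr0.
  - left; rewrite /d -[arc_rev (arc_plus e)]/(arc_minus e).
    rewrite -[arc_rev (arc_minus e)]/(arc_plus e) (negPf zp) (negPf zm) hm.
    by rewrite !mulr1n subrr.
move/eqP: ha0; apply; have := netd a0; rewrite !d0 subrr => /esym/eqP.
by rewrite mulrn_eq0 => /eqP.
Qed.

Theorem theorem5p3 (R : realType) (k : nat) (hk : (2 <= k)%N)
    (V E : finType) (ends : E -> V * V) (hG : two_edge_connected ends)
    (c : diarc E -> nat) (hc : (2 < k)%N -> no_free_edge c)
    (z : {ffun diarc E -> R})
    (hext : extreme_point (flow_polytope ends k) z)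
    (hopt : optimal_solution c (flow_polytope ends k) z) :
  [/\ forall e : E, 0 < z (arc_plus e) -> 0 < z (arc_minus e) ->
        z (arc_plus e) + z (arc_minus e) = 1,
      forall e : E, z (arc_plus e) \is a Num.int <-> z (arc_minus e) \is a Num.int,
      forall a : diarc E, z a \isn't a Num.int -> z a = 2^-1
    & k_flow ends k (integral_arcs z) z].
Proof.
have two e := @optimal_two_sided R k V E ends c z e hc hopt.
have net := @extreme_net_integral R k V E ends z hext two.
have [[/balancedP zbal zsum z_ge0] _] := hext.
have sum_rev (a : diarc E) : z (arc_plus a.1) + z (arc_minus a.1) = z a + z (arc_rev a).
  by case: a => e [] //=; rewrite addrC.
have int_of_rev a : z (arc_rev a) \is a Num.int -> z a \is a Num.int.
  by move=> zr; rewrite -[z a](subrK (z (arc_rev a))) rpredD.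
have half a : z a \isn't a Num.int -> z a = 2^-1 /\ z (arc_rev a) = 2^-1.
  move=> za.
  have int_rev : z (arc_rev a) \isn't a Num.int.
    by apply: contra za; exact: int_of_rev.
  have gt0 b : z b \isn't a Num.int -> 0 < z b.
    by move=> zb; rewrite lt_def z_ge0 andbT; apply: contra zb => /eqP ->; exact: rpred0.
  have s1 : z a + z (arc_rev a) = 1.
    rewrite -sum_rev; apply: two.
      by case: (a) (gt0 _ za) (gt0 _ int_rev) => e [].
    by case: (a) (gt0 _ za) (gt0 _ int_rev) => e [].
  have /intrP [m zm] := net a.
  (* Two positive numbers with sum 1 differ by less than 1 in absolute value. *)
  have m0 : m = 0.
    have := gt0 _ za; have := gt0 _ int_rev => g1 g2.
    have : m%:~R < 1%:~R :> R by rewrite -zm; lra.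
    have : (-1)%:~R < m%:~R :> R by rewrite -zm; lra.
    rewrite !ltr_int; lia.
  by rewrite m0 in zm; split; lra.
have two_int e : z (arc_plus e) \is a Num.int <-> z (arc_minus e) \is a Num.int.
  by split=> ?; apply: int_of_rev.
split=> //; first by move=> a /half [].
split=> [e|a|].
- apply/negP; rewrite !inE => /andP[/andP[/intrP [m zm] p1] /andP[/intrP [n zn] n1]].
  have := two e p1 n1; rewrite zm zn -intrD => /eqP.
  rewrite -[1]/(1%:~R) eqr_int => /eqP.
  by move: p1 n1; rewrite zm zn !ltr0z; lia.
- rewrite inE => /andP[/intrP [m zm] za].
  have : z a <= k%:R - 1.
    have /andP[_ +] := zsum a.1; rewrite sum_rev; apply: le_trans.
    by rewrite lerDl.
  move: za; rewrite zm ltr0z => m0.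
  rewrite lerBrDr -[k%:R]/(k%:~R) -[1]/(1%:~R) -intrD ler_int => mk.
  by exists `|m|%N; [lia | rewrite natr_absz gtr0_norm].
(* Non-integral arcs come in opposite pairs of equal value 1/2, so dropping them changes no net
   value. *)
apply/balancedP => v; rewrite -[RHS](zbal v); apply: eq_bigr => a _.
rewrite !in_setT !mulr1n !inE.
have part b : z b *+ ((z b \is a Num.int) && (0 < z b)) = z b *+ (z b \is a Num.int).
  have := z_ge0 b; rewrite le0r => /orP[/eqP ->|->]; last by rewrite andbT.
  by rewrite !mul0rn.
rewrite !part.
have [za|za] := boolP (z a \is a Num.int).
  have zr : z (arc_rev a) \is a Num.int.
    by apply: int_of_rev; rewrite arc_revK.
  by rewrite zr !mulr1n.
have zr : z (arc_rev a) \isn't a Num.int.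
  by apply: contra za; exact: int_of_rev.
by rewrite (negPf zr) !mulr0n; have [-> ->] := half _ za; rewrite !subrr.
Qed.
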